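(* Let $R$ be a $2$-$\sqrt{J}U$ ring and let $S$ be a unit closed subring of $R$. Then $S$ is a $2$-$\sqrt{J}U$ ring.
   Context: All rings are associative with identity $1\neq 0$. For a ring $R$, $J(R)$ denotes the Jacobson radical, $U(R)$ the group of units, and $\sqrt{J(R)}=\{x\in R : x^m\in J(R)\text{ for some } m\ge 1\}$. A ring $R$ is a $2$-$\sqrt{J}U$ ring if $u^2\in 1+\sqrt{J(R)}$ for every $u\in U(R)$. A subring $S$ of $R$ is unit closed if $U(S)=U(R)\cap S$. *)

(* Defs.v *)
From HB Require Import structures.
From mathcomp Require Import all_boot all_algebra ring_quotient.
From mathcomp Require Import boolp classical_sets.
Set Implicit Arguments.
Unset Strict Implicit.
Unset Printing Implicit Defensive.
Import GRing.Theory.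
Local Open Scope classical_set_scope.
Local Open Scope ring_scope.

(* Stated for [nzRingType] rather than [unitRingType]: a sub-[unitRingType]
   would be compatible with the inverse of the ambient ring by construction,
   so every such subring would automatically be unit closed. *)
Definition units (R : nzRingType) : set R :=
  [set u | exists v : R, u * v = 1 /\ v * u = 1].

(* [idealr_closed] is closure under [a * u + v] together with [1 \notin M], that
   is, M is a proper left ideal. With the classical axioms of [boolp], [{pred R}]
   ranges over all subsets of R. *)
Definition maximal_left_ideal (R : nzRingType) (M : {pred R}) : Prop :=
  idealr_closed M /\
  forall I : {pred R}, idealr_closed I -> {subset M <= I} -> I =i M.

Definition jacobson (R : nzRingType) : set R :=
  \bigcap_(M in @maximal_left_ideal R) [set` M].

Definition sqrt_jacobson (R : nzRingType) : set R :=
  [set x | exists2 m : nat, (1 <= m)%N & jacobson (x ^+ m)].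

Definition two_sqrtJU (R : nzRingType) : Prop :=
  forall u : R, units u -> exists2 x : R, sqrt_jacobson x & u ^+ 2 = 1 + x.

(* A subring of R is a ring structure S on a subtype {x : R | x \in P} for which
   [val : S -> R] is a ring morphism; in particular S contains the 1 of R. *)
Definition unit_closed (R : nzRingType) (P : {pred R}) (S : subNzRingType P)
    : Prop :=
  [set val s | s in @units S] = @units R `&` [set` P].

(* Main.v *)
Require Import Defs.
From mathcomp Require Import all_boot all_algebra.
From mathcomp Require Import ring_quotient boolp classical_sets.

(** The key fact is that [J(R)] meets a unit closed subring [S] inside [J(S)].
    An element [z] lies in the Jacobson radical exactly when every [1 - r * z]
    has a left inverse ([jacobsonP]), and then each [1 - r * z] is a two-sided
    unit ([jacobson_units]).  If [z] in [S] lies in [J(R)], then for [r] in [S]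
    the element [1 - r * z] of [S] is a unit of [R], hence a unit of [S] by unit
    closedness, so [z] lies in [J(S)] ([jacobson_unit_closed]).

    For a unit [u] of [S], some power of [u ^+ 2 - 1], computed in [R], lies in
    [J(R)] because [R] is a 2-sqrt(J)U ring; this power is an element of [S],
    so it lies in [J(S)]. *)

Set Implicit Arguments.
Unset Strict Implicit.
Unset Printing Implicit Defensive.
Import GRing.Theory.
Local Open Scope ring_scope.

Lemma idealr_closedMl (R : nzRingType) (I : {pred R}) (a x : R) :
  idealr_closed I -> x \in I -> a * x \in I.
Proof. by move=> [I0 _ IS] xI; rewrite -[a * x]addr0 IS. Qed.

(** Krull's theorem: every proper left ideal is contained in a maximal one. *)
Lemma idealr_sub_maximal (R : nzRingType) (I : {pred R}) :
  idealr_closed I ->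
  exists2 M : {pred R}, maximal_left_ideal M & {subset I <= M}.
Proof.
move=> idI.
(* Zorn's lemma is applied to the sets whose union with I is a proper left
   ideal, so that the empty chain has the upper bound set0. *)
pose J (A : set R) : {pred R} := [pred x | `[< A x >] || (x \in I)].
have JP A x : reflect (A x \/ x \in I) (x \in J A).
  by rewrite inE; apply: (iffP orP) => -[/asboolP|]; by [left|right].
have [|A [idA maxA]] := @Zorn_bigcup R (fun A => idealr_closed (J A)).
  move=> F FJ totF; have [I0 I1 IS] := idI; split.
  - by apply/JP; right.
  - apply/negP => /JP[[X FX X1]|]; last exact/negP.
    by have [_ /negP nX1 _] := FJ X FX; apply: nX1; apply/JP; left.
  - have lift X a u v : F X -> u \in J X -> v \in J X ->
        a * u + v \in J (\bigcup_(X in F) X)%classic.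
      move=> FX uX vX; have [_ _ XS] := FJ X FX.
      have /JP[Xuv|Iuv] := XS a u v uX vX; apply/JP; last by right.
      by left; exists X.
    move=> a u v /JP[[X FX Xu]|Iu] /JP[[Y FY Yv]|Iv].
    + have [XY|YX] := totF X Y FX FY.
        by apply: (lift Y) => //; apply/JP; left => //; exact: XY.
      by apply: (lift X) => //; apply/JP; left => //; exact: YX.
    + by apply: (lift X) => //; apply/JP; [left|right].
    + by apply: (lift Y) => //; apply/JP; [right|left].
    + by apply/JP; right; exact: IS.
exists (J A); last by move=> x xI; apply/JP; right.
split=> // K idK AK x; apply/idP/idP => [xK|]; last exact: AK.
apply/JP; left; apply: contrapT => nAx.
have IK y : y \in I -> y \in K by move=> yI; apply: AK; apply/JP; right.
apply: (maxA [set` K]%classic).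
  rewrite properEneq; split; last by move=> y Ay; apply: AK; apply/JP; left.
  by apply/eqP => AE; apply: nAx; rewrite AE.
suff -> : J [set` K]%classic = K by [].
apply/funext => y; apply/idP/idP => [/JP[//|/IK//]|yK].
by apply/JP; left.
Qed.

(** An element is in the Jacobson radical, defined as the intersection of the
    maximal left ideals, if and only if it is left quasi-regular together with
    all its left multiples. *)
Lemma jacobsonP (R : nzRingType) (z : R) :
  jacobson z <-> forall r : R, exists v : R, v * (1 - r * z) = 1.
Proof.
split=> [Jz r|qr M maxM].
- (* Otherwise the proper left ideal R (1 - r z) lies in a maximal left
     ideal, which also contains z, hence 1. *)
  apply: contrapT => nv.
  pose I : {pred R} := [pred x | `[< exists v, x = v * (1 - r * z) >]].
  have idI : idealr_closed I.
    split.
    + by apply/asboolP; exists 0; rewrite mul0r.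
    + by apply/asboolP => -[v v1]; apply: nv; exists v.
    + move=> a _ _ /asboolP[v ->] /asboolP[w ->].
      by apply/asboolP; exists (a * v + w); rewrite mulrDl mulrA.
  have [M maxM IM] := idealr_sub_maximal idI.
  have [idM _] := maxM; have [_ /negP M1 MS] := idM; apply: M1.
  rewrite -(subrK (r * z) 1) -[1 - _]mul1r; apply: MS.
    by apply: IM; apply/asboolP; exists 1; rewrite mul1r.
  by apply: idealr_closedMl => //; exact: (Jz M maxM).
- (* M + R z is a proper left ideal, since 1 = m + r z with m in M would make m
     left invertible; by maximality it equals M, and it contains z. *)
  have [idM max] := maxM; have [M0 /negP M1 MS] := idM.
  pose I : {pred R} :=
    [pred x | `[< exists m r, m \in M /\ x = m + r * z >]].
  have idI : idealr_closed I.
    split.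
    + by apply/asboolP; exists 0, 0; rewrite mul0r addr0.
    + apply/asboolP => -[m [r [mM E]]]; apply: M1.
      have [v <-] := qr r; rewrite {1}E addrK.
      exact: idealr_closedMl.
    + move=> a _ _ /asboolP[m [r [mM ->]]] /asboolP[n [s [nM ->]]].
      apply/asboolP; exists (a * m + n), (a * r + s); split; first exact: MS.
      by rewrite mulrDr mulrDl mulrA addrACA.
  have MI : {subset M <= I}.
    by move=> m mM; apply/asboolP; exists m, 0; rewrite mul0r addr0.
  rewrite /= -(max I idI MI); apply/asboolP; exists 0, 1.
  by rewrite mul1r add0r.
Qed.

Lemma jacobson_units (R : nzRingType) (z r : R) :
  jacobson z -> units (1 - r * z).
Proof.
move=> /jacobsonP qr; have [v vK] := qr r.
(* The left inverse v = 1 + v r z is itself left invertible, hence a unit. *)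
have [w wK] := qr (- (v * r)).
have vE : 1 - - (v * r) * z = v.
  by rewrite mulNr opprK -{2}[v](subrK (v * (r * z))) -{2}(mulr1 v) -mulrBr vK
    mulrA.
rewrite vE in wK; exists v; split=> //.
have <- // : w = 1 - r * z.
by rewrite -(mulr1 w) -[in LHS]vK mulrA wK mul1r.
Qed.

Lemma unit_closed_units (R : nzRingType) (P : {pred R})
    (S : subNzRingType P) (s : S) :
  unit_closed S -> units s <-> units (val s).
Proof.
move=> uS; split=> [us|uvs].
  have : [set val t | t in @units S]%classic (val s) by exists s.
  by rewrite uS => -[].
have : (@units R `&` [set` P])%classic (val s) by split=> //; exact: valP.
by rewrite -uS => -[t ut /val_inj <-].
Qed.

Lemma jacobson_unit_closed (R : nzRingType) (P : {pred R})
    (S : subNzRingType P) (s : S) :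
  unit_closed S -> jacobson (val s) -> jacobson s.
Proof.
move=> uS Js; apply/jacobsonP => r.
have : units (1 - r * s).
  apply/unit_closed_units => //.
  by rewrite rmorphB rmorph1 rmorphM; exact: jacobson_units.
by move=> [v [_ vK]]; exists v.
Qed.

Theorem proposition2p10 (R : nzRingType) (P : {pred R}) (S : subNzRingType P) :
  two_sqrtJU R -> unit_closed S -> two_sqrtJU S.
Proof.
move=> hR uS u uu.
have [x [m m_gt0 Jx] u2E] := hR _ ((unit_closed_units u uS).1 uu).
exists (u ^+ 2 - 1); last by rewrite addrC subrK.
exists m => //; apply: jacobson_unit_closed => //.
by rewrite rmorphXn rmorphB rmorphXn rmorph1 u2E addrC addKr.
Qed.
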